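(* Let $E$ be a directed graph, $R$ a commutative ring with unit, and $\phi$ a ring homomorphism of $L_R(E)$ into a ring $S$. Then $\phi$ is injective if and only if the following two conditions are satisfied: (G1) $\phi(rv)\neq 0$ for all $v\in E^0$ and all $r\in R\setminus\{0\}$; and (G2) $\phi(q(\alpha))\neq 0$ for all cycles $\alpha$ in $E$ without an exit and all nonzero polynomials $q\in R[x]$.
   Context: A directed graph $E=(E^0,E^1,r,s)$ consists of sets $E^0$ (vertices), $E^1$ (edges) and maps $r,s\colon E^1\to E^0$ (range, source); no countability is assumed. A path of length $n\ge1$ is a sequence $\alpha=e_1\cdots e_n$ of edges with $r(e_i)=s(e_{i+1})$; $s(\alpha)=s(e_1)$, $r(\alpha)=r(e_n)$. A cycle is a path $\alpha$ of length at least one with $s(\alpha)=r(\alpha)$ (vertices may be repeated). An exit for $\alpha=e_1\cdots e_n$ is an edge $e$ such that, for some $i$, $s(e)=s(e_i)$ and $e\neq e_i$. $L_R(E)$ is the universal (not necessarily unital) $R$-algebra generated by $\{v,e,e^*: v\in E^0, e\in E^1\}$ subject to: (1) the $v\in E^0$ are pairwise orthogonal idempotents; (2) $s(e)e=er(e)=e$; (3) $r(e)e^*=e^*s(e)=e^*$; (4) $e^*f=\delta_{e,f}r(e)$ for $e,f\in E^1$; (5) $v=\sum_{s(f)=v}ff^*$ whenever $0<|s^{-1}(v)|<\infty$. A path is identified with the product of its edges in $L_R(E)$. For a cycle $\alpha$ without an exit and $q(x)=\sum_{n=0}^m k_nx^n\in R[x]$, $q(\alpha):=k_0 s(\alpha)+\sum_{n=1}^m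 k_n\alpha^n\in L_R(E)$. Rings need not be unital and ring homomorphisms need not preserve units. *)

(* Defs.v *)
From Stdlib Require List.
From HB Require Import structures.
From mathcomp Require Import all_boot all_order all_algebra.
From mathcomp Require Import boolp.

Set Implicit Arguments.
Unset Strict Implicit.
Unset Printing Implicit Defensive.

Import GRing.Theory.
Local Open Scope quotient_scope.
Local Open Scope ring_scope.

Reserved Notation "x ** y" (at level 40, left associativity).

(** * Rings and algebras without unit *)

HB.mixin Record Zmodule_isRng S of GRing.Zmodule S := {
  rmul : S -> S -> S;
  rmulA : associative rmul;
  rmulDl : left_distributive rmul +%R;
  rmulDr : right_distributive rmul +%R
}.

#[short(type="rngType")]
HB.structure Definition Rng := {S of Zmodule_isRng S & GRing.Zmodule S}.

Notation "x ** y" := (rmul x y) : ring_scope.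

HB.mixin Record Lmodule_Rng_isRngAlgebra (R : comPzRingType) A
    of GRing.Lmodule R A & Rng A := {
  rscaleAl : forall (a : R) (x y : A), a *: (x ** y) = (a *: x) ** y;
  rscaleAr : forall (a : R) (x y : A), a *: (x ** y) = x ** (a *: y)
}.

#[short(type="rngAlgType")]
HB.structure Definition RngAlgebra (R : comPzRingType) :=
  {A of Lmodule_Rng_isRngAlgebra R A & GRing.Lmodule R A & Rng A}.

(* Only meaningful for n >= 1, in the absence of a unit; the value at n = 0
   is the junk value 0. *)
Definition rpow (S : rngType) (x : S) (n : nat) : S := iterop n rmul x 0.

(** * Directed graphs *)

Record digraph := Digraph {
  vertex : Type;
  edge : Type;
  src : edge -> vertex;
  rng : edge -> vertex
}.

Fixpoint chain (E : digraph) (e : edge E) (p : seq (edge E)) : Prop :=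
  if p is f :: p' then rng e = src f /\ chain f p' else True.

(* Paths of length at least one, the first edge being kept apart. *)
Record gpath (E : digraph) := GPath {
  phead : edge E;
  ptail : seq (edge E);
  _ : chain phead ptail
}.

Section Paths.
Variables (E : digraph) (alpha : gpath E).

Definition pedges : seq (edge E) := phead alpha :: ptail alpha.
Definition psrc : vertex E := src (phead alpha).
Definition prng : vertex E := rng (last (phead alpha) (ptail alpha)).

Definition is_cycle : Prop := psrc = prng.

Definition is_exit (e : edge E) : Prop :=
  exists2 f, List.In f pedges & src e = src f /\ e <> f.

Definition has_exit : Prop := exists e, is_exit e.

End Paths.

(* [l] enumerates without repetition the edges emitted by [v], so in particular
   there are finitely many of them. *)
Definition emits (E : digraph) (v : vertex E) (l : seq (edge E)) : Prop :=
  List.NoDup l /\ forall f, List.In f l <-> src f = v.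

(** * Leavitt path algebras *)

(* The families of elements of an algebra subject to the relations that define
   the Leavitt path algebra. *)
Record leavitt_family (R : comPzRingType) (E : digraph) (A : rngAlgType R)
    (pv : vertex E -> A) (pe pg : edge E -> A) : Prop := LeavittFamily {
  lf_vv : forall v, pv v ** pv v = pv v;
  lf_vw : forall v w, v <> w -> pv v ** pv w = 0;
  lf_se : forall e, pv (src e) ** pe e = pe e;
  lf_er : forall e, pe e ** pv (rng e) = pe e;
  lf_rg : forall e, pv (rng e) ** pg e = pg e;
  lf_gs : forall e, pg e ** pv (src e) = pg e;
  lf_ge : forall e, pg e ** pe e = pv (rng e);
  lf_gf : forall e f, e <> f -> pg e ** pe f = 0;
  lf_sum : forall v l, emits v l -> l <> [::] ->
    pv v = \sum_(f <- l) pe f ** pg f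
}.

(* The universal algebra is obtained as the set of formal expressions in the
   generators, modulo the congruence generated by the axioms of (non-unital)
   algebras and the Leavitt relations. *)
Inductive lterm (R : comPzRingType) (E : digraph) : Type :=
  | TVertex of vertex E
  | TEdge of edge E
  | TGhost of edge E
  | TZero
  | TAdd of lterm R E & lterm R E
  | TScale of R & lterm R E
  | TMul of lterm R E & lterm R E.

Arguments TVertex {R E}.
Arguments TEdge {R E}.
Arguments TGhost {R E}.
Arguments TZero {R E}.

Inductive lcong (R : comPzRingType) (E : digraph) :
    lterm R E -> lterm R E -> Prop :=
  | LC_refl t : lcong t t
  | LC_sym t u : lcong t u -> lcong u t
  | LC_trans t u w : lcong t u -> lcong u w -> lcong t w
  | LC_add t t' u u' : lcong t t' -> lcong u u' -> lcong (TAdd t u) (TAdd t' u')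
  | LC_scale a t t' : lcong t t' -> lcong (TScale a t) (TScale a t')
  | LC_mul t t' u u' : lcong t t' -> lcong u u' -> lcong (TMul t u) (TMul t' u')
  | LC_addA t u w : lcong (TAdd t (TAdd u w)) (TAdd (TAdd t u) w)
  | LC_addC t u : lcong (TAdd t u) (TAdd u t)
  | LC_add0 t : lcong (TAdd TZero t) t
  | LC_scaleA a b t : lcong (TScale a (TScale b t)) (TScale (a * b) t)
  | LC_scale0 t : lcong (TScale 0 t) TZero
  | LC_scale1 t : lcong (TScale 1 t) t
  | LC_scaleDr a t u :
      lcong (TScale a (TAdd t u)) (TAdd (TScale a t) (TScale a u))
  | LC_scaleDl a b t :
      lcong (TScale (a + b) t) (TAdd (TScale a t) (TScale b t))
  | LC_mulA t u w : lcong (TMul t (TMul u w)) (TMul (TMul t u) w)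
  | LC_mulDl t u w : lcong (TMul (TAdd t u) w) (TAdd (TMul t w) (TMul u w))
  | LC_mulDr t u w : lcong (TMul t (TAdd u w)) (TAdd (TMul t u) (TMul t w))
  | LC_scaleAl a t u : lcong (TScale a (TMul t u)) (TMul (TScale a t) u)
  | LC_scaleAr a t u : lcong (TScale a (TMul t u)) (TMul t (TScale a u))
  | LC_vv v : lcong (TMul (TVertex v) (TVertex v)) (TVertex v)
  | LC_vw v w : v <> w -> lcong (TMul (TVertex v) (TVertex w)) TZero
  | LC_se e : lcong (TMul (TVertex (src e)) (TEdge e)) (TEdge e)
  | LC_er e : lcong (TMul (TEdge e) (TVertex (rng e))) (TEdge e)
  | LC_rg e : lcong (TMul (TVertex (rng e)) (TGhost e)) (TGhost e)
  | LC_gs e : lcong (TMul (TGhost e) (TVertex (src e))) (TGhost e)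
  | LC_ge e : lcong (TMul (TGhost e) (TEdge e)) (TVertex (rng e))
  | LC_gf e f : e <> f -> lcong (TMul (TGhost e) (TEdge f)) TZero
  | LC_sum v l : emits v l -> l <> [::] ->
      lcong (TVertex v)
        (foldr (fun f t => TAdd (TMul (TEdge f) (TGhost f)) t) TZero l).

HB.instance Definition _ (R : comPzRingType) (E : digraph) :=
  gen_eqMixin (lterm R E).
HB.instance Definition _ (R : comPzRingType) (E : digraph) :=
  gen_choiceMixin (lterm R E).

Section Leavitt.
Variables (R : comPzRingType) (E : digraph).
Implicit Types t u w : lterm R E.

Definition lcongb t u : bool := `[< lcong t u >].

Lemma lcongb_refl : reflexive lcongb.
Proof. by move=> t; apply/asboolP; exact: LC_refl. Qed.

Lemma lcongb_sym : symmetric lcongb.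
Proof. by move=> t u; apply/asboolP/asboolP; exact: LC_sym. Qed.

Lemma lcongb_trans : transitive lcongb.
Proof. by move=> u t w /asboolP tu /asboolP uw; apply/asboolP/(LC_trans tu). Qed.

Canonical lcong_equiv := EquivRel lcongb lcongb_refl lcongb_sym lcongb_trans.

Definition leavitt : Type := {eq_quot lcong_equiv}.

HB.instance Definition _ := Choice.on leavitt.

Definition lpi (t : lterm R E) : leavitt := \pi_({eq_quot lcong_equiv}) t.

Definition lrepr (x : leavitt) : lterm R E := @repr _ {eq_quot lcong_equiv} x.

Lemma lreprK x : lpi (lrepr x) = x.
Proof. exact: (@reprK _ {eq_quot lcong_equiv}). Qed.

Lemma lpiP t u : lpi t = lpi u <-> lcong t u.
Proof. by split=> [/eqquotP/asboolP|tu] //; apply/eqquotP/asboolP. Qed.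

Lemma lrepr_pi t : lcong (lrepr (lpi t)) t.
Proof. by apply/lpiP; rewrite lreprK. Qed.

Definition ladd (x y : leavitt) := lpi (TAdd (lrepr x) (lrepr y)).
Definition lscale (a : R) (x : leavitt) := lpi (TScale a (lrepr x)).
Definition lmul (x y : leavitt) := lpi (TMul (lrepr x) (lrepr y)).

Lemma lpi_add t u : lpi (TAdd t u) = ladd (lpi t) (lpi u).
Proof. by apply/lpiP/LC_add; apply/LC_sym/lrepr_pi. Qed.

Lemma lpi_scale a t : lpi (TScale a t) = lscale a (lpi t).
Proof. by apply/lpiP/LC_scale; apply/LC_sym/lrepr_pi. Qed.

Lemma lpi_mul t u : lpi (TMul t u) = lmul (lpi t) (lpi u).
Proof. by apply/lpiP/LC_mul; apply/LC_sym/lrepr_pi. Qed.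

Let lpiE := (lpi_add, lpi_scale, lpi_mul).

Lemma laddA : associative ladd.
Proof.
move=> x y z; rewrite -(lreprK x) -(lreprK y) -(lreprK z) -!lpiE.
exact/lpiP/LC_addA.
Qed.

Lemma laddC : commutative ladd.
Proof.
by move=> x y; rewrite -(lreprK x) -(lreprK y) -!lpiE; apply/lpiP/LC_addC.
Qed.

Lemma ladd0 : left_id (lpi TZero) ladd.
Proof. by move=> x; rewrite -(lreprK x) -!lpiE; apply/lpiP/LC_add0. Qed.

HB.instance Definition _ := GRing.isNmodule.Build leavitt laddA laddC ladd0.

Lemma lscaleA a b x : lscale a (lscale b x) = lscale (a * b) x.
Proof. by rewrite -(lreprK x) -!lpiE; apply/lpiP/LC_scaleA. Qed.

Lemma lscale0 x : lscale 0 x = 0.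
Proof. by rewrite -(lreprK x) -!lpiE; apply/lpiP/LC_scale0. Qed.

Lemma lscale1 : left_id 1 lscale.
Proof. by move=> x; rewrite -(lreprK x) -!lpiE; apply/lpiP/LC_scale1. Qed.

Lemma lpiD t u : lpi (TAdd t u) = lpi t + lpi u.
Proof. exact: lpi_add. Qed.

Lemma lscaleDr : right_distributive lscale +%R.
Proof.
move=> a x y; rewrite -(lreprK x) -(lreprK y) -!(lpiD, lpi_scale).
exact/lpiP/LC_scaleDr.
Qed.

Lemma lscaleDl x : {morph lscale^~ x : a b / a + b}.
Proof.
move=> a b; rewrite -(lreprK x) -!(lpiD, lpi_scale).
exact/lpiP/LC_scaleDl.
Qed.

HB.instance Definition _ := GRing.Nmodule_isLSemiModule.Build R leavitt
  lscaleA lscale0 lscale1 lscaleDr lscaleDl.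
HB.instance Definition _ := GRing.LSemiModule_isLmodule.Build R leavitt.

Lemma lmulA : associative lmul.
Proof.
move=> x y z; rewrite -(lreprK x) -(lreprK y) -(lreprK z) -!lpiE.
exact/lpiP/LC_mulA.
Qed.

Lemma lmulDl : left_distributive lmul +%R.
Proof.
move=> x y z; rewrite -(lreprK x) -(lreprK y) -(lreprK z).
rewrite -!(lpiD, lpi_mul); exact/lpiP/LC_mulDl.
Qed.

Lemma lmulDr : right_distributive lmul +%R.
Proof.
move=> x y z; rewrite -(lreprK x) -(lreprK y) -(lreprK z).
rewrite -!(lpiD, lpi_mul); exact/lpiP/LC_mulDr.
Qed.

HB.instance Definition _ := Zmodule_isRng.Build leavitt lmulA lmulDl lmulDr.

Lemma lpiZ a t : lpi (TScale a t) = a *: lpi t.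
Proof. exact: lpi_scale. Qed.

Lemma lpiM t u : lpi (TMul t u) = lpi t ** lpi u.
Proof. exact: lpi_mul. Qed.

Lemma lscaleAl (a : R) (x y : leavitt) : a *: (x ** y) = (a *: x) ** y.
Proof.
rewrite -(lreprK x) -(lreprK y) -!(lpiZ, lpiM); exact/lpiP/LC_scaleAl.
Qed.

Lemma lscaleAr (a : R) (x y : leavitt) : a *: (x ** y) = x ** (a *: y).
Proof.
rewrite -(lreprK x) -(lreprK y) -!(lpiZ, lpiM); exact/lpiP/LC_scaleAr.
Qed.

HB.instance Definition _ :=
  Lmodule_Rng_isRngAlgebra.Build R leavitt lscaleAl lscaleAr.

Definition lvertex (v : vertex E) : leavitt := lpi (TVertex v).
Definition ledge (e : edge E) : leavitt := lpi (TEdge e).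
Definition lghost (e : edge E) : leavitt := lpi (TGhost e).

End Leavitt.

Arguments lvertex {R E}.
Arguments ledge {R E}.
Arguments lghost {R E}.

Lemma leavitt_familyP (R : comPzRingType) (E : digraph) :
  @leavitt_family R E (leavitt R E) lvertex ledge lghost.
Proof.
split=> [v|v w vw|e|e|e|e|e|e f ef|v l vl l0].
- by rewrite -lpiM; apply/lpiP/LC_vv.
- by rewrite -lpiM; apply/lpiP/LC_vw.
- by rewrite -lpiM; apply/lpiP/LC_se.
- by rewrite -lpiM; apply/lpiP/LC_er.
- by rewrite -lpiM; apply/lpiP/LC_rg.
- by rewrite -lpiM; apply/lpiP/LC_gs.
- by rewrite -lpiM; apply/lpiP/LC_ge.
- by rewrite -lpiM; apply/lpiP/LC_gf.
have /lpiP := LC_sum R vl l0; rewrite -/(lvertex v) => ->.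
elim: l {vl l0} => [|f l IHl] /=; first by rewrite big_nil.
by rewrite big_cons lpiD lpiM IHl.
Qed.

(* The universal property. *)
Lemma leavitt_universal (R : comPzRingType) (E : digraph) (A : rngAlgType R)
    (pv : vertex E -> A) (pe pg : edge E -> A) :
  leavitt_family pv pe pg ->
  exists! h : leavitt R E -> A,
    [/\ (forall x y, h (x + y) = h x + h y),
        (forall (a : R) x, h (a *: x) = a *: h x),
        (forall x y, h (x ** y) = h x ** h y) &
        [/\ forall v, h (lvertex v) = pv v, forall e, h (ledge e) = pe e &
            forall e, h (lghost e) = pg e]].
Proof.
move=> F.
pose ev := fix ev (t : lterm R E) : A := match t with
  | TVertex v => pv v | TEdge e => pe e | TGhost e => pg e | TZero => 0
  | TAdd t u => ev t + ev u | TScale a t => a *: ev t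
  | TMul t u => ev t ** ev u end.
have evP t u : lcong t u -> ev t = ev u.
  elim=> {t u} //=; try by move=> *; congruence.
  - by move=> *; rewrite addrA.
  - by move=> *; rewrite addrC.
  - by move=> *; rewrite add0r.
  - by move=> *; rewrite scalerA.
  - by move=> *; rewrite scale0r.
  - by move=> *; rewrite scale1r.
  - by move=> *; rewrite scalerDr.
  - by move=> *; rewrite scalerDl.
  - by move=> *; rewrite rmulA.
  - by move=> *; rewrite rmulDl.
  - by move=> *; rewrite rmulDr.
  - by move=> *; rewrite rscaleAl.
  - by move=> *; rewrite rscaleAr.
  - exact: lf_vv F.
  - exact: lf_vw F.
  - exact: lf_se F.
  - exact: lf_er F.
  - exact: lf_rg F.
  - exact: lf_gs F.
  - exact: lf_ge F.
  - exact: lf_gf F.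
  move=> v l vl l0; rewrite (lf_sum F vl l0).
  by elim: l {vl l0} => [|f l IHl] /=; rewrite ?big_nil // big_cons IHl.
have evpi t : ev (lrepr (lpi t)) = ev t by apply/evP/lrepr_pi.
exists (fun x => ev (lrepr x)); split.
  split; [|by move=> a x; exact: evpi|by move=> x y; exact: evpi|].
    by move=> x y; exact: evpi.
  by split=> z; exact: evpi.
move=> h [hD hZ hM [hv he hg]]; apply/funext => x.
rewrite -{2}(lreprK x); elim: (lrepr x) => /= [v|e|e||t IHt u IHu|a t IHt|t IHt u IHu].
- by rewrite -hv.
- by rewrite -he.
- by rewrite -hg.
- rewrite -[lpi TZero]/(0 : leavitt R E).
  by rewrite -(scale0r (0 : leavitt R E)) hZ scale0r.
- by rewrite IHt IHu -hD -lpiD.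
- by rewrite IHt -hZ -lpiZ.
- by rewrite IHt IHu -hM -lpiM.
Qed.

Definition path_elt (R : comPzRingType) (E : digraph) (alpha : gpath E) :
    leavitt R E :=
  foldl (fun x e => x ** ledge e) (ledge (phead alpha)) (ptail alpha).

(* Polynomials are given by their coefficient sequences, trailing zeroes being
   allowed: MathComp's {poly R} would exclude the trivial ring R = 0. *)
Definition nonzero_poly (R : comPzRingType) (q : seq R) : Prop :=
  exists n, q`_n <> 0.

(* The value q(alpha), whose constant term is carried by the source vertex. *)
Definition cycle_eval (R : comPzRingType) (E : digraph) (q : seq R)
    (alpha : gpath E) : leavitt R E :=
  q`_0 *: lvertex (psrc alpha)
  + \sum_(1 <= n < size q) q`_n *: rpow (path_elt R alpha) n.

(* Main.v *)
Require Import Defs.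
From HB Require Import structures.
From mathcomp Require Import all_boot all_order all_algebra.
From mathcomp Require Import boolp.
From mathcomp Require Import zify.

(* A nonzero element of the kernel is multiplied by paths and ghost paths until
   it contradicts (G1) or (G2).  Right multiplication by edges removes ghost
   edges, which reduces the question to linear combinations of real paths; if
   p is a path of minimal length in such a combination, multiplying by p^* on
   the left and by r(p) on the right leaves k w plus a combination of closed
   paths at w = r(p), with k <> 0.  Let c be a shortest closed path at w.  If c
   has an exit, a long walk t that follows c several times and then leaves it
   satisfies t^* g t = 0 for all the closed paths g that occur, so that
   k r(t) is in the kernel, against (G1).  Otherwise all closed paths at w are
   powers of c, and (G2) applies.  If there is no closed path, k w is already in
   the kernel.

   Conversely, r v and q(alpha) are nonzero because they act as nonzero
   operators in the representation of L_R(E) on the functions of a maximal path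
   and an integer degree. *)

Set Implicit Arguments.
Unset Strict Implicit.
Unset Printing Implicit Defensive.

Import GRing.Theory.
Local Open Scope ring_scope.

(** Classical equality tests on vertices and edges make membership, [undup] and filtering available
    for arbitrary graphs. *)
HB.instance Definition _ (E : digraph) := gen_eqMixin (vertex E).
HB.instance Definition _ (E : digraph) := gen_eqMixin (edge E).

(** * Sums and products in rings without unit; finite sequences *)

Section Rng.
Variable S : rngType.
Implicit Types x y : S.

Lemma rmul0l x : 0 ** x = 0.
Proof. by apply: (addrI (0 ** x)); rewrite -rmulDl !addr0. Qed.

Lemma rmul0r x : x ** 0 = 0.
Proof. by apply: (addrI (x ** 0)); rewrite -rmulDr !addr0. Qed.

Lemma rmul_suml I (s : seq I) (P : pred I) (F : I -> S) y :
  (\sum_(i <- s | P i) F i) ** y = \sum_(i <- s | P i) F i ** y.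
Proof.
by apply: (big_morph (rmul^~ y)) => [a b|]; rewrite ?rmulDl ?rmul0l.
Qed.

Lemma rmul_sumr I (s : seq I) (P : pred I) (F : I -> S) x :
  x ** (\sum_(i <- s | P i) F i) = \sum_(i <- s | P i) x ** F i.
Proof. by apply: (big_morph (rmul x)) => [a b|]; rewrite ?rmulDr ?rmul0r. Qed.

Lemma rpowS x n : rpow x n.+2 = x ** rpow x n.+1.
Proof. by []. Qed.

End Rng.

Lemma InP (T : eqType) (x : T) (s : seq T) : List.In x s <-> x \in s.
Proof.
elim: s => [|y s IHs] //=; rewrite inE; split.
  by case=> [->|/IHs ->]; rewrite ?eqxx ?orbT.
by case/predU1P => [->|/IHs]; [left | right].
Qed.

Lemma NoDupP (T : eqType) (s : seq T) : List.NoDup s <-> uniq s.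
Proof.
elim: s => [|x s IHs]; first by split=> // _; constructor.
split=> [H|/= /andP[xs us]].
  inversion_clear H as [|? ? xs us] => /=; apply/andP; split; last exact/IHs.
  by apply/negP => /InP.
by constructor; [move/InP; apply/negP | apply/IHs].
Qed.

Lemma sum_pred1_uniq (V : nmodType) (T : eqType) (s : seq T) (a : T)
    (F : T -> V) :
  uniq s -> a \in s -> \sum_(i <- s | i == a) F i = F a.
Proof. by move=> us sa; rewrite -big_filter filter_pred1_uniq // big_seq1. Qed.

(** * Walks *)

Section Walks.
Variable E : digraph.
Implicit Types (v w : vertex E) (e f : edge E) (l m c : seq (edge E)).

(** Unlike a [gpath], a walk may be empty, so its starting vertex is given separately. *)
Fixpoint walk v l : bool :=
  if l is e :: l' then (src e == v) && walk (rng e) l' else true.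

Definition wend v l : vertex E := last v (map (@rng E) l).

Definition power c n : seq (edge E) := flatten (nseq n c).

Lemma wend_cat v l m : wend v (l ++ m) = wend (wend v l) m.
Proof. by rewrite /wend map_cat last_cat. Qed.

Lemma walk_cat v l m : walk v (l ++ m) = walk v l && walk (wend v l) m.
Proof. by elim: l v => //= e l IHl v; rewrite IHl andbA. Qed.

Lemma powerS c n : power c n.+1 = c ++ power c n.
Proof. by []. Qed.

Lemma powerSr c n : power c n.+1 = power c n ++ c.
Proof.
elim: n => [|n IHn]; first exact: cats0.
by rewrite [LHS]powerS [in LHS]IHn catA.
Qed.

Lemma size_power c n : size (power c n) = (n * size c)%N.
Proof. by elim: n => [|n IHn] //; rewrite powerS size_cat IHn mulSn. Qed.

Lemma power_closed w c n :
  walk w c -> wend w c = w -> walk w (power c n) /\ wend w (power c n) = w.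
Proof.
move=> wc cw; elim: n => [|n [IHw IHe]] //.
by rewrite powerS walk_cat wend_cat wc cw.
Qed.

(* Past the exit [e], the walk [c c ... c a e] loses the period [size c] of its
   initial part, which prevents it from having any other small period. *)
Lemma aperiodic_walk w c N :
    walk w c -> wend w c = w ->
    (exists e f, [/\ f \in c, src e = src f & e <> f]) ->
  exists2 t, walk w t &
    forall g, (0 < size g <= N)%N -> take (size t) (g ++ t) <> t.
Proof.
move=> wc cw [e [f [fc sef ef]]].
have [a [b Dc]] : exists a b, c = a ++ f :: b.
  by case/splitPr: fc => a b; exists a, b.
(* With [N.+1] turns, [u] is at least as long as [g] and [c] together as soon as [size g <= N]. *)
pose u := power c N.+1 ++ a; pose t := rcons u e.
have [wp pw] := power_closed N.+1 wc cw.
exists t.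
  rewrite /t /u -cats1 -catA walk_cat wp pw /=.
  move: wc; rewrite Dc !walk_cat /= => /andP[-> /andP[/eqP <- _]].
  by rewrite sef eqxx.
move=> g /andP[g0 gN] gt.
have st : size t = (size u).+1 by rewrite size_rcons.
have su : size u = (N.+1 * size c + size a)%N by rewrite size_cat size_power.
have sc : size c = (size a + (size b).+1)%N by rewrite Dc size_cat.
have Lb : (size g + size c <= size u)%N by nia.
(* [s] is the walk that keeps following [c]: it agrees with [t] up to [u], then has [f] where [t]
   has [e]. *)
pose s := power c N.+2.
have sE : s = rcons u f ++ b.
  by rewrite /s powerSr {2}Dc /u -cats1 -!catA.
have nth_t i : (i < size u)%N -> nth e t i = nth e s i.
  by move=> iu; rewrite sE nth_cat size_rcons !nth_rcons iu ltnW.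
have nth_s : nth e s (size u) = f.
  by rewrite sE nth_cat size_rcons ltnSn nth_rcons ltnn eqxx.
have per_t i : (size g <= i <= size u)%N -> nth e t i = nth e t (i - size g).
  move=> /andP[gi iu]; rewrite -{1}gt nth_take ?st // nth_cat.
  by rewrite ltnNge gi.
have per_s i : (size c <= i <= size u)%N -> nth e s i = nth e s (i - size c).
  move=> /andP[ci iu]; rewrite {2}/s powerSr nth_cat size_power.
  rewrite {1}/s powerS nth_cat ltnNge ci /=.
  by rewrite (_ : (i - size c < N.+1 * size c)%N) //; nia.
(* From the index [size u] one goes back by [size g] and then [size c] starting in [t], and in the
   other order starting in [s]. Both end at the same entry of [s], so that [e = f]. *)
apply: ef; have <- : nth e t (size u) = e by rewrite nth_rcons ltnn eqxx.
rewrite -nth_s.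
rewrite per_t; last by lia.
rewrite nth_t; last by lia.
rewrite per_s; last by lia.
rewrite [RHS]per_s; last by lia.
rewrite -[RHS]nth_t; last by lia.
rewrite per_t; last by lia.
rewrite nth_t; last by lia.
by congr nth; lia.
Qed.

(** Without an exit every step is forced: an edge of [l] with the source of the corresponding edge
    of [c] is that edge. *)
Lemma walk_noexit v c l :
    (forall e f, f \in c -> src e = src f -> e = f) ->
    walk v c -> walk v l -> (size c <= size l)%N -> take (size c) l = c.
Proof.
elim: c v l => [|f c IHc] v l nox; first by rewrite take0.
case: l => [|e l] //= /andP[/eqP sf wc] /andP[/eqP se wl] cl.
have Def : e = f by apply: nox; rewrite ?mem_head // se sf.
rewrite Def in wl *; congr (_ :: _); apply: IHc wc wl cl => e' f' f'c.
by apply: nox; rewrite inE f'c orbT.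
Qed.

(** Strong induction on the length of [l]: by minimality [l] is at least as long as [c], hence
    starts with [c], and what remains is again closed at [w]. *)
Lemma closed_noexit w c l :
    (forall e f, f \in c -> src e = src f -> e = f) ->
    walk w c -> wend w c = w ->
    (forall m, m <> [::] -> walk w m -> wend w m = w -> (size c <= size m)%N) ->
    (0 < size c)%N ->
    walk w l -> wend w l = w -> exists n, l = power c n.
Proof.
move=> nox wc cw cmin c0; have [n] := ubnP (size l).
elim: n l => // n IHn l; rewrite ltnS => ln wl lw.
case: (l =P [::]) => [->|l0]; first by exists 0%N.
have cl := cmin _ l0 wl lw; have tc := walk_noexit nox wc wl cl.
move: (cat_take_drop (size c) l) wl lw; rewrite tc => Dl.
rewrite -Dl walk_cat wend_cat wc cw /= => wd dw.
have [|k Dk] := IHn (drop (size c) l) _ wd dw; first by rewrite size_drop; lia.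
by exists k.+1; rewrite powerS -Dk.
Qed.

End Walks.

(** * Paths and ghost paths in the Leavitt path algebra *)

Section LeavittPaths.
Variables (R : comPzRingType) (E : digraph).
Implicit Types (v w : vertex E) (e f : edge E) (l m c : seq (edge E)).
Notation L := (leavitt R E).
Notation LF := (leavitt_familyP R E).
Notation lv v := (lvertex v : L).
Notation le e := (ledge e : L).
Notation lg e := (lghost e : L).

Lemma scale_rmull (a : R) (x y : L) : (a *: x) ** y = a *: (x ** y).
Proof. by rewrite rscaleAl. Qed.

Lemma scale_rmulr (a : R) (x y : L) : x ** (a *: y) = a *: (x ** y).
Proof. by rewrite rscaleAr. Qed.

Lemma vertexM v w : lv v ** lv w = if v == w then lv v else 0.
Proof. by case: eqP => [->|]; [exact: (lf_vv LF) | exact: (lf_vw LF)]. Qed.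

Lemma vertex_edge v e : lv v ** le e = if v == src e then le e else 0.
Proof.
by rewrite -(lf_se LF e) rmulA vertexM; case: eqP => [->|]; rewrite ?rmul0l.
Qed.

Lemma edge_vertex e v : le e ** lv v = if rng e == v then le e else 0.
Proof.
by rewrite -(lf_er LF e) -rmulA vertexM; case: eqP => [->|]; rewrite ?rmul0r.
Qed.

Lemma ghost_vertex e v : lg e ** lv v = if src e == v then lg e else 0.
Proof.
by rewrite -(lf_gs LF e) -rmulA vertexM; case: eqP => [->|]; rewrite ?rmul0r.
Qed.

Lemma vertex_ghost v e : lv v ** lg e = if v == rng e then lg e else 0.
Proof.
by rewrite -(lf_rg LF e) rmulA vertexM; case: eqP => [->|]; rewrite ?rmul0l.
Qed.

Lemma ghost_edge e f : lg e ** le f = if e == f then lv (rng e) else 0.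
Proof. by case: eqP => [->|]; [exact: (lf_ge LF) | exact: (lf_gf LF)]. Qed.

Definition pelt v l : L := foldl (fun x e => x ** le e) (lv v) l.

(** The ghost path $l^*=e_n^*\cdots e_1^*$; the leading vertex gives a value to the empty walk. *)
Definition gelt v l : L := foldr (fun e x => x ** lg e) (lv (wend v l)) l.

Arguments pelt : simpl never.
Arguments gelt : simpl never.

Lemma gelt_cons v e l : gelt v (e :: l) = gelt (rng e) l ** lg e.
Proof. by []. Qed.

Lemma pelt_rcons v l e : pelt v (rcons l e) = pelt v l ** le e.
Proof. by rewrite /pelt foldl_rcons. Qed.

Lemma pelt_wend v l : pelt v l ** lv (wend v l) = pelt v l.
Proof.
elim/last_ind: l => [|l e _]; first by rewrite vertexM eqxx.
by rewrite pelt_rcons /wend map_rcons last_rcons -rmulA edge_vertex eqxx.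
Qed.

Lemma pelt_vertex v l w :
  pelt v l ** lv w = if wend v l == w then pelt v l else 0.
Proof.
rewrite -{1}pelt_wend -rmulA vertexM.
by case: eqP => // _; rewrite (pelt_wend, rmul0r).
Qed.

Lemma pelt_cat v l m : pelt v (l ++ m) = pelt v l ** pelt (wend v l) m.
Proof.
elim/last_ind: m => [|m e IHm]; first by rewrite cats0 pelt_wend.
by rewrite -rcons_cat !pelt_rcons IHm rmulA.
Qed.

Lemma vertex_pelt w v l :
  lv w ** pelt v l = if w == v then pelt v l else 0.
Proof.
elim/last_ind: l => [|l e IHl]; first by rewrite vertexM; case: eqP => // ->.
by rewrite !pelt_rcons rmulA IHl; case: eqP; rewrite ?rmul0l.
Qed.

Lemma pelt_cons e l : pelt (src e) (e :: l) = le e ** pelt (rng e) l.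
Proof.
by rewrite -cat1s pelt_cat /= /pelt /= vertex_edge eqxx.
Qed.

Lemma pelt_power w c n : wend w c = w ->
  pelt w (power c n.+1) = rpow (pelt w c) n.+1.
Proof.
move=> cw; elim: n => [|n IHn]; first by rewrite /power /= cats0.
by rewrite powerS pelt_cat cw IHn rpowS.
Qed.

(** Edges cancel in pairs from the middle by $e^*f=\delta_{e,f}r(e)$; the length condition leaves
    only real edges. *)
Lemma gelt_pelt v l w m : walk v l -> walk w m -> (size l <= size m)%N ->
  gelt v l ** pelt w m =
  if (v == w) && (take (size l) m == l) then pelt (wend v l) (drop (size l) m)
  else 0.
Proof.
elim: l v w m => [|e l IHl] v w m.
  move=> _ _ _; rewrite take0 drop0 andbT.
  by rewrite /gelt /wend /= vertex_pelt; case: eqP => // ->.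
case: m => [|f m] //= /andP[/eqP <- wl] /andP[/eqP <- wm] lm.
rewrite gelt_cons -rmulA pelt_cons [lg e ** _]rmulA ghost_edge eqseq_cons.
rewrite [f == e]eq_sym.
case: (e =P f) wm => [<-|ef] wm /=; last by rewrite andbF rmul0l rmul0r.
by rewrite vertex_pelt !eqxx IHl // eqxx.
Qed.

(** Finite sums of vertices replace the missing unit. Allowing every larger [V] lets the supports of
    two summands be merged. *)
Lemma local_unit (x : L) : exists U : seq (vertex E), forall V, uniq V ->
  {subset U <= V} -> x ** (\sum_(v <- V) lv v) = x.
Proof.
have vP v V : v \in V -> uniq V -> lv v ** (\sum_(w <- V) lv w) = lv v.
  move=> vV uV; rewrite rmul_sumr.
  rewrite -[RHS](@sum_pred1_uniq _ _ V v (fun=> lv v)) //.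
  by rewrite [RHS]big_mkcond; apply: eq_bigr => w _; rewrite vertexM eq_sym.
rewrite -(lreprK x).
elim: (lrepr x) => {x} [v|e|e||t [U IHt] u [U' IHu]|a t [U IHt]|t _ u [U IHu]].
- by exists [:: v] => V uV sV; apply: vP => //; rewrite sV ?mem_head.
- exists [:: rng e] => V uV sV; rewrite -/(ledge e) -(lf_er LF e) -rmulA vP //.
  by rewrite sV ?mem_head.
- exists [:: src e] => V uV sV; rewrite -/(lghost e) -(lf_gs LF e) -rmulA vP //.
  by rewrite sV ?mem_head.
- by exists [::] => V _ _; apply: rmul0l.
- exists (U ++ U') => V uV sV; rewrite lpiD rmulDl IHt ?IHu // => v vU.
    by apply: sV; rewrite mem_cat vU orbT.
  by apply: sV; rewrite mem_cat vU.
- by exists U => V uV sV; rewrite lpiZ -rscaleAl IHt.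
- by exists U => V uV sV; rewrite lpiM -rmulA IHu.
Qed.

Lemma eq0_vertex (x : L) : (forall v, x ** lv v = 0) -> x = 0.
Proof.
move=> x0; have [U HU] := local_unit x.
rewrite -(HU (undup U)) ?undup_uniq //; last by move=> v; rewrite mem_undup.
by rewrite rmul_sumr big1.
Qed.

(** * The filtration by the number of ghost edges *)

Inductive ghost_span (d : nat) : L -> Prop :=
  | Span0 : ghost_span d 0
  | SpanD x y of ghost_span d x & ghost_span d y : ghost_span d (x + y)
  | SpanM (a : R) v l w m of (size m <= d)%N :
      ghost_span d (a *: (pelt v l ** gelt w m)).

Lemma ghost_span_le d d' x : (d <= d')%N -> ghost_span d x -> ghost_span d' x.
Proof.
move=> dd'; elim=> [|y z _ ? _ ?|a v l w m md]; try by constructor.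
by apply: SpanM; apply: leq_trans dd'.
Qed.

Lemma ghost_span_vertex d x v : ghost_span d x -> ghost_span d (x ** lv v).
Proof.
elim=> [|y z _ IHy _ IHz|a u l w m md].
- by rewrite rmul0l; constructor.
- by rewrite rmulDl; constructor.
rewrite scale_rmull; case: m md => [|e m] md.
  rewrite -rmulA /gelt /wend /= vertexM; case: ifP => _.
    exact: (@SpanM d a u l w [::]).
  by rewrite rmul0r scaler0; constructor.
rewrite gelt_cons -!rmulA ghost_vertex; case: ifP => _.
  exact: (@SpanM d a u l w (e :: m)).
by rewrite !rmul0r scaler0; constructor.
Qed.

(** The edge cancels the last ghost edge or kills the monomial; if there is no ghost edge, it
    prolongs the real path, which fits the truncated predecessor at [d = 0]. *)
Lemma ghost_span_edge d x e : ghost_span d x -> ghost_span d.-1 (x ** le e).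
Proof.
elim=> [|y z _ IHy _ IHz|a v l w m md].
- by rewrite rmul0l; constructor.
- by rewrite rmulDl; constructor.
rewrite scale_rmull; case: m md => [|f m] md.
  rewrite -rmulA /gelt /wend /= vertex_edge; case: ifP => _.
    rewrite -pelt_rcons -pelt_wend.
    exact: (@SpanM _ a v (rcons l e) (wend v (rcons l e)) [::]).
  by rewrite rmul0r scaler0; constructor.
rewrite gelt_cons -!rmulA ghost_edge; case: ifP => _.
  rewrite rmulA -scale_rmull; apply: ghost_span_vertex; apply: SpanM.
  by case: d md.
by rewrite !rmul0r scaler0; constructor.
Qed.

Lemma ghost_span_ghost d x e : ghost_span d x -> ghost_span d.+1 (x ** lg e).
Proof.
elim=> [|y z _ IHy _ IHz|a v l w m md].
- by rewrite rmul0l; constructor.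
- by rewrite rmulDl; constructor.
rewrite scale_rmull; case: m md => [|f m] md.
  rewrite -rmulA /gelt /wend /= vertex_ghost; case: ifP => [_|_].
    have -> : lg e = gelt (src e) [:: e].
      by rewrite /gelt /wend /= vertex_ghost eqxx.
    exact: SpanM.
  by rewrite rmul0r scaler0; constructor.
by rewrite -rmulA; exact: (@SpanM _ a v l w (e :: f :: m)).
Qed.

Lemma ghost_span_scale d a x : ghost_span d x -> ghost_span d (a *: x).
Proof.
elim=> [|y z _ IHy _ IHz|b v l w m md].
- by rewrite scaler0; constructor.
- by rewrite scalerDr; constructor.
by rewrite scalerA; constructor.
Qed.

Lemma ghost_span_total x : exists d, ghost_span d x.
Proof.
(* A product is treated as successive right multiplications by generators, so that no product of two
   monomials has to be reduced. *)
rewrite -(lreprK x); have H t : forall y, (exists d, ghost_span d y) ->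
    exists d, ghost_span d (y ** lpi t).
  elim: t => [v|e|e||t IHt u IHu|a t IHt|t IHt u IHu] y dy.
  - by case: dy => d dy; exists d; apply: ghost_span_vertex.
  - by case: dy => d dy; exists d.-1; apply: ghost_span_edge.
  - by case: dy => d dy; exists d.+1; apply: ghost_span_ghost.
  - by exists 0%N; rewrite (_ : y ** _ = 0) ?rmul0r //; constructor.
  - have [[d yt] [d' yu]] := (IHt _ dy, IHu _ dy).
    exists (maxn d d'); rewrite lpiD rmulDr; constructor.
      exact: ghost_span_le (leq_maxl _ _) yt.
    exact: ghost_span_le (leq_maxr _ _) yu.
  - have [d yt] := IHt _ dy; exists d.
    by rewrite lpiZ -rscaleAr; apply: ghost_span_scale.
  - by rewrite lpiM rmulA; apply: IHu; apply: IHt.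
elim: (lrepr x) => {x} [v|e|e||t [d dt] u [d' du]|a t [d dt]|t IHt u IHu].
- exists 0%N; have := @SpanM 0 1 v [::] v [::] isT.
  by rewrite /pelt /gelt /wend /= vertexM eqxx scale1r.
- exists 0%N; have := @SpanM 0 1 (src e) [:: e] (rng e) [::] isT.
  by rewrite /pelt /gelt /wend /= vertex_edge eqxx edge_vertex eqxx scale1r.
- exists 1%N; have := @SpanM 1 1 (rng e) [::] (src e) [:: e] isT.
  by rewrite /pelt /gelt /wend /= rmulA vertexM eqxx vertex_ghost eqxx scale1r.
- by exists 0%N; constructor.
- exists (maxn d d'); rewrite lpiD; constructor.
    exact: ghost_span_le (leq_maxl _ _) dt.
  exact: ghost_span_le (leq_maxr _ _) du.
- by exists d; rewrite lpiZ; apply: ghost_span_scale.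
- by rewrite lpiM; apply: H.
Qed.

(** * Linear combinations of real paths *)

Definition real_elt (s : seq (R * (vertex E * seq (edge E)))) : L :=
  \sum_(t <- s) t.1 *: pelt t.2.1 t.2.2.

Lemma real_elt_vertex s v : real_elt s ** lv v =
  real_elt [seq t <- s | wend t.2.1 t.2.2 == v].
Proof.
rewrite /real_elt rmul_suml big_filter [RHS]big_mkcond.
apply: eq_bigr => t _; rewrite scale_rmull pelt_vertex.
by case: ifP; rewrite ?scaler0.
Qed.

(** A path may occur several times in [s]; its true coefficient is the sum over its occurrences. *)
Definition coef (s : seq (R * (vertex E * seq (edge E)))) p : R :=
  \sum_(t <- s | t.2 == p) t.1.

Lemma real_eltE s : real_elt s =
  \sum_(p <- undup (map snd s)) coef s p *: pelt p.1 p.2.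
Proof.
under eq_bigr => p _ do rewrite scaler_suml.
rewrite (exchange_big_dep predT) //= /real_elt big_seq [RHS]big_seq.
apply: eq_bigr => t ts; under eq_bigl => p do rewrite eq_sym.
rewrite (@sum_pred1_uniq _ _ _ t.2 (fun p => t.1 *: pelt p.1 p.2)) //.
  exact: undup_uniq.
by rewrite mem_undup map_f.
Qed.

Lemma pelt_nwalk v l : ~~ walk v l -> pelt v l = 0.
Proof.
elim: l v => [|e l IHl] v //=; rewrite negb_and => H.
rewrite -cat1s pelt_cat [pelt v _]vertex_edge [_ == src e]eq_sym.
by case/orP: H => [/negbTE->|/IHl->]; rewrite ?rmul0l ?rmul0r.
Qed.

(** A finite partial sum of the type in relation (5), meaningful also at infinite emitters. *)
Definition edge_proj (F : seq (edge E)) : L := \sum_(f <- F) le f ** lg f.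

Lemma ghost_proj e F : uniq F -> e \in F -> lg e ** edge_proj F = lg e.
Proof.
move=> uF eF; rewrite rmul_sumr -[RHS](@sum_pred1_uniq _ _ F e (fun=> lg e)) //.
rewrite [RHS]big_mkcond; apply: eq_bigr => f _.
rewrite rmulA ghost_edge eq_sym; case: eqP => [->|_]; last by rewrite rmul0l.
by rewrite vertex_ghost eqxx.
Qed.

(** [z] gathers the monomials that contain ghost edges. Each ends in some $e^*$, and [F] collects
    these [e], so that [edge_proj F'] fixes [z] on the right by [ghost_proj]. *)
Lemma ghost_span_split d x : ghost_span d x ->
  exists s z (F : seq (edge E)),
    [/\ {in s, forall t, walk t.2.1 t.2.2}, x = real_elt s + z,
       d = 0%N -> z = 0 &
       forall F' : seq (edge E), uniq F' -> {subset F <= F'} ->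
         z ** edge_proj F' = z].
Proof.
elim=> [|y y' _ [s [z [F [ws -> z0 zF]]]] _ [s' [z' [F' [ws' -> z0' zF']]]]
       |a v l w m md].
- exists [::], 0, [::]; split=> //; first by rewrite /real_elt big_nil addr0.
  by move=> F' _ _; rewrite rmul0l.
- exists (s ++ s'), (z + z'), (F ++ F'); split.
  - by move=> t; rewrite mem_cat => /orP[/ws|/ws'].
  - by rewrite /real_elt big_cat /= addrACA.
  - by move=> d0; rewrite z0 // z0' // addr0.
  move=> G uG sG; rewrite rmulDl zF ?zF' // => e eF.
    by apply: sG; rewrite mem_cat eF orbT.
  by apply: sG; rewrite mem_cat eF.
case: m md => [|e m] md.
  case: (boolP ((wend v l == w) && walk v l)) => [/andP[/eqP <- wl]|vw].
    exists [:: (a, (v, l))], 0, [::].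
    split=> // [t|| F' _ _]; last exact: rmul0l.
      by rewrite inE => /eqP ->.
    by rewrite /real_elt big_seq1 addr0 pelt_wend.
  exists [::], 0, [::]; split=> // [|F' _ _]; last exact: rmul0l.
  rewrite /real_elt big_nil addr0 pelt_vertex; case: ifP vw => /= _.
    by move/pelt_nwalk->; rewrite scaler0.
  by rewrite scaler0.
exists [::], (a *: (pelt v l ** gelt w (e :: m))), [:: e].
split=> [//|||].
- by rewrite /real_elt big_nil add0r.
- by move=> d0; rewrite d0 in md.
move=> F' uF' sF'; rewrite scale_rmull gelt_cons -!rmulA ghost_proj //.
by rewrite sF' ?mem_head.
Qed.

End LeavittPaths.

Lemma argmin_nat (T : Type) (f : T -> nat) (P : T -> Prop) :
  (exists x, P x) -> exists2 x, P x & forall y, P y -> (f x <= f y)%N.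
Proof.
move=> [x0 Px0]; pose Q n := `[< exists2 x, P x & f x = n >].
have exQ : exists n, Q n by exists (f x0); apply/asboolP; exists x0.
case: (ex_minnP exQ) => n /asboolP[x Px <-] minn; exists x => // y Py.
by apply: minn; apply/asboolP; exists y.
Qed.

(** * Elements of the kernel *)

Section Reduction.
Variables (E : digraph) (R : comPzRingType) (S : rngType).
Variables (phi : {additive leavitt R E -> S}).
Hypothesis phiM : {morph phi : x y / x ** y >-> x ** y}.
Hypothesis G1 : forall (v : vertex E) (r : R),
  r <> 0 -> phi (r *: lvertex v) <> 0.
Hypothesis G2 : forall alpha : gpath E, is_cycle alpha -> ~ has_exit alpha ->
  forall q : seq R, nonzero_poly q -> phi (cycle_eval q alpha) <> 0.

Lemma kerMr x y : phi x = 0 -> phi (x ** y) = 0.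
Proof. by rewrite phiM => ->; rewrite rmul0l. Qed.

Lemma kerMl x y : phi y = 0 -> phi (x ** y) = 0.
Proof. by rewrite phiM => ->; rewrite rmul0r. Qed.

Implicit Types (g : seq (R * seq (edge E))) (w : vertex E).

Lemma exit_notin_ker w k g c : k <> 0 ->
    {in g, forall t, [/\ walk w t.2, wend w t.2 = w & t.2 <> [::]]} ->
    walk w c -> wend w c = w ->
    (exists e f, [/\ f \in c, src e = src f & e <> f]) ->
  phi (k *: lvertex w + \sum_(t <- g) t.1 *: pelt R w t.2) <> 0.
Proof.
move=> k0 gP wc cw ex phi0.
(* The bound covers all closed walks of [g], so $t^*ut=0$ for each of them: [t] is not an initial
   part of [u ++ t]. *)
have [t wt tP] := aperiodic_walk (\max_(t <- g) size t.2) wc cw ex.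
have /(@G1 (wend w t) k) := k0; apply.
have := kerMr (pelt R w t) (kerMl (gelt R w t) phi0); congr (phi _ = 0).
rewrite rmulDr rmulDl scale_rmulr scale_rmull -rmulA vertex_pelt eqxx.
rewrite gelt_pelt // eqxx take_size eqxx drop_size.
rewrite rmul_sumr rmul_suml big_seq big1 ?addr0 // => u ug.
have [wu uw u0] := gP u ug.
rewrite scale_rmulr scale_rmull -rmulA.
rewrite -[in X in _ ** (_ ** X)]uw -pelt_cat.
rewrite gelt_pelt // ?size_cat ?leq_addl //; last first.
  by rewrite walk_cat wu uw.
rewrite eqxx; case: eqP => [/tP[]|]; last by rewrite scaler0.
rewrite lt0n size_eq0; apply/andP; split; first exact/eqP.
exact: (@leq_bigmax_seq _ g xpredT (fun t => size t.2)).
Qed.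

Lemma noexit_notin_ker w k g c : k <> 0 ->
    {in g, forall t, [/\ walk w t.2, wend w t.2 = w & t.2 <> [::]]} ->
    (forall m, m <> [::] -> walk w m -> wend w m = w -> (size c <= size m)%N) ->
    walk w c -> wend w c = w -> c <> [::] ->
    (forall e f, f \in c -> src e = src f -> e = f) ->
  phi (k *: lvertex w + \sum_(t <- g) t.1 *: pelt R w t.2) <> 0.
Proof.
case: c => [//|e l] k0 gP cmin wc cw _ nox.
have /andP[/eqP Dw wl] := wc.
have cl : chain e l.
  elim: l e wl {cmin wc cw nox Dw} => //= f l IHl e /andP[/eqP <- wl].
  by split=> //; apply: IHl.
pose alpha := GPath cl.
have pE : path_elt R alpha = pelt R w (e :: l).
  by rewrite /path_elt /pelt /= vertex_edge -Dw eqxx.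
have alphaC : is_cycle alpha.
  by rewrite /is_cycle /psrc /prng -last_map /= Dw -[LHS]cw.
have alphaX : ~ has_exit alpha.
  by move=> [x [f /InP fc [xf]]]; apply; apply: nox xf.
pose N := (\max_(t <- g) size t.2)%N.
(* Every walk in [g] is a power of the cycle, with the exponent determined by its length. The
   coefficients are collected by exponent; degree 0 receives only [k], since no walk in [g] is
   empty. *)
pose c n := if n == 0%N then k
  else \sum_(t <- g | size t.2 == (n * size (e :: l))%N) t.1.
have := @G2 alpha alphaC alphaX (mkseq c N.+1) _.
move=> /(_ (ex_intro _ 0%N k0)); congr (phi _ <> 0).
rewrite /cycle_eval size_mkseq nth_mkseq // [psrc _]Dw; congr (_ + _).
transitivity (\sum_(1 <= n < N.+1)
    \sum_(t <- g | size t.2 == (n * size (e :: l))%N) t.1 *: pelt R w t.2).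
  rewrite !big_nat; apply: eq_bigr => n /andP[n0 nN].
  rewrite nth_mkseq // /c eqn0Ngt n0 /= scaler_suml.
  rewrite big_seq_cond [RHS]big_seq_cond.
  apply: eq_bigr => t /andP[tg /eqP st]; congr (_ *: _).
  have [wt tw _] := gP t tg.
  have [m Dt] := closed_noexit nox wc cw cmin isT wt tw.
  move: st; rewrite Dt size_power => /eqP.
  rewrite eqn_pmul2r // => /eqP ->.
  by rewrite -(prednK n0) pelt_power // -pE.
(* After the exchange each [t] contributes for one exponent [m] only, and [m] lies between 1 and [N]
   because [t.2] is nonempty and no shorter than [m]. *)
rewrite (exchange_big_dep predT) //= big_seq [RHS]big_seq.
apply: eq_bigr => t tg.
have [wt tw t0] := gP t tg.
have [m Dt] := closed_noexit nox wc cw cmin isT wt tw.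
have st : size t.2 = (m * (size l).+1)%N by rewrite Dt size_power.
rewrite (eq_bigl (fun n => n == m)); last first.
  by move=> n; rewrite st eqn_pmul2r // eq_sym.
rewrite (@sum_pred1_uniq _ _ _ m (fun=> t.1 *: pelt R w t.2)) ?iota_uniq //.
rewrite mem_index_iota ltnS lt0n; apply/andP; split.
  by apply/eqP => m0; apply: t0; rewrite Dt m0.
have := @leq_bigmax_seq _ g xpredT (fun t => size t.2) t tg isT.
by apply: leq_trans; rewrite st leq_pmulr.
Qed.

Lemma closed_notin_ker w k g : k <> 0 ->
    {in g, forall t, [/\ walk w t.2, wend w t.2 = w & t.2 <> [::]]} ->
  phi (k *: lvertex w + \sum_(t <- g) t.1 *: pelt R w t.2) <> 0.
Proof.
move=> k0 gP; pose P m := [/\ m <> [::], walk w m & wend w m = w].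
case: (pselect (exists m, P m)) => [/(argmin_nat size)[c [c0 wc cw] cmin]|noP].
  case: (pselect (exists e f, [/\ f \in c, src e = src f & e <> f]))
      => [ex|nex].
    exact: exit_notin_ker wc cw ex.
  apply: noexit_notin_ker wc cw c0 _ => // [m m0 wm mw|e f fc ef].
    exact: cmin.
  by apply: contrapT => nef; apply: nex; exists e, f.
rewrite big_seq big1 ?addr0; first exact: G1.
by move=> t /gP[wt tw t0]; case: noP; exists t.2.
Qed.

(** The conclusion is about coefficients, not just about [real_elt s], so that it can be transported
    along the extension of paths by an edge. *)
Lemma real_ker s : {in s, forall t, walk t.2.1 t.2.2} ->
  phi (real_elt s) = 0 -> forall p, coef s p = 0.
Proof.
move=> ws phi0 p; apply: contrapT => sp0.
have := argmin_nat (fun q => size q.2)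
  (ex_intro (fun q => coef s q <> 0) p sp0).
move=> {p sp0}[p sp0 minp].
set P := undup (map snd s); set w := wend p.1 p.2.
have inP q : coef s q <> 0 -> q \in P.
  apply: contra_notT; rewrite mem_undup => qs.
  rewrite /coef big_seq_cond big1 // => t /andP[ts /eqP tq].
  by rewrite -tq map_f in qs.
have wP q : q \in P -> walk q.1 q.2.
  by rewrite mem_undup => /mapP[t ts ->]; apply: ws.
(* These paths survive multiplication by $p^*$ and $w$: they prolong [p] by a closed walk at [w],
   which is nonempty when [q] differs from [p]. *)
pose good q := [&& p.1 == q.1, take (size p.2) q.2 == p.2 &
  wend w (drop (size p.2) q.2) == w].
pose g := [seq (coef s q, drop (size p.2) q.2) |
  q <- P & [&& q != p, coef s q != 0 & good q]].
apply: (@closed_notin_ker w (coef s p) g) => //.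
  move=> x /mapP[q]; rewrite mem_filter => /andP[].
  move=> /and3P[qp _ /and3P[pq tq eq]] qP -> {x}.
  have := wP q qP.
  rewrite -{1}(cat_take_drop (size p.2) q.2) (eqP tq) -(eqP pq).
  rewrite walk_cat => /andP[_ wd]; split=> //; first exact/eqP.
  move=> d0; case/eqP: qp; rewrite [q]surjective_pairing [p]surjective_pairing.
  rewrite -(eqP pq) -(cat_take_drop (size p.2) q.2) (eqP tq).
  by rewrite [drop _ _]d0 cats0.
have := kerMr (lvertex w) (kerMl (gelt R p.1 p.2) phi0); congr (phi _ = 0).
rewrite real_eltE -/P rmul_sumr rmul_suml.
rewrite (bigD1_seq p) ?undup_uniq ?inP //=; congr (_ + _).
  rewrite scale_rmulr scale_rmull gelt_pelt ?wP ?inP //.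
  by rewrite eqxx take_size eqxx drop_size /= vertexM eqxx.
rewrite /g big_map big_filter [LHS]big_mkcond [RHS]big_mkcond.
apply: eq_big_seq => q qP.
case: (q =P p) => //= _; case: (coef s q =P 0) => [->|/= sq].
  by rewrite scale0r rmul0r rmul0l.
rewrite scale_rmulr scale_rmull gelt_pelt ?wP ?inP //; last exact: minp.
rewrite /good andbA; case: ifP => /= _; last by rewrite rmul0l scaler0.
by rewrite pelt_vertex; case: ifP; rewrite ?scaler0.
Qed.

Lemma real_ker_eq0 s : {in s, forall t, walk t.2.1 t.2.2} ->
  phi (real_elt s) = 0 -> real_elt s = 0.
Proof.
move=> ws phi0; rewrite real_eltE big1 // => p _.
by rewrite (real_ker ws phi0) scale0r.
Qed.

(** Appending [e] is injective on paths, so the coefficients of the paths ending at [src e] are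
    those of the product with [e], which vanish by [real_ker]. *)
Lemma real_edge_ker_eq0 s e : {in s, forall t, walk t.2.1 t.2.2} ->
  phi (real_elt s ** ledge e) = 0 -> real_elt s ** lvertex (src e) = 0.
Proof.
move=> ws phi0; pose s' := [seq t <- s | wend t.2.1 t.2.2 == src e].
have ws' : {in s', forall t, walk t.2.1 t.2.2}.
  by move=> t; rewrite mem_filter => /andP[_ /ws].
have Ds' : real_elt s ** lvertex (src e) = real_elt s'.
  exact: real_elt_vertex.
pose ext (t : R * (vertex E * seq (edge E))) :=
  (t.1, (t.2.1, rcons t.2.2 e)).
have Dext : real_elt s' ** ledge e = real_elt (map ext s').
  rewrite /real_elt rmul_suml big_map; apply: eq_bigr => t _.
  by rewrite scale_rmull -pelt_rcons.
have wext : {in map ext s', forall t, walk t.2.1 t.2.2}.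
  move=> _ /mapP[t ts' ->] /=; rewrite -cats1 walk_cat ws' //= andbT.
  by move: ts'; rewrite mem_filter eq_sym => /andP[].
have := real_ker wext.
rewrite -Dext -Ds' -rmulA vertex_edge eqxx => /(_ phi0) c0.
rewrite Ds' real_eltE big1 // => p _.
rewrite (_ : coef s' p = 0) ?scale0r // -(c0 (p.1, rcons p.2 e)).
rewrite /coef big_map; apply: eq_bigl => t /=.
rewrite [t.2]surjective_pairing [p in LHS]surjective_pairing !xpair_eqE.
by rewrite eqseq_rcons eqxx andbT.
Qed.

(** Induction on [d]: every [x e] has a smaller bound and so vanishes. It remains to deduce
    [x v = 0] at each vertex, according to the edges that [v] emits. *)
Lemma ghost_span_ker_eq0 d x : ghost_span d x -> phi x = 0 -> x = 0.
Proof.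
elim: d x => [|d IHd] x dx phi0.
  have [s [z [F [ws Dx z0 _]]]] := ghost_span_split dx.
  by move: phi0; rewrite Dx z0 ?addr0 //; apply: real_ker_eq0.
have xe e : x ** ledge e = 0.
  by apply: IHd; [exact: (ghost_span_edge e dx) | exact: kerMr].
have [s [z [F [ws Dx _ zF]]]] := ghost_span_split dx.
have {}zF := zF (undup F) (undup_uniq F) (fun e => etrans (mem_undup F e)).
apply: eq0_vertex => v; pose Fv := [seq e <- undup F | src e == v].
have zv : z ** lvertex v = z ** edge_proj R Fv.
  rewrite -{1}zF -rmulA; congr (_ ** _).
  rewrite /edge_proj rmul_suml big_filter [RHS]big_mkcond.
  apply: eq_bigr => e _; rewrite -rmulA ghost_vertex.
  by case: eqP; rewrite ?rmul0r.
(* As [F] is finite, all infinite emitters fall under the first case. There [e] kills [z], so the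
   real part of [x] vanishes at [v], and the rest is a sum of terms $zff^*$ with $zf=xf=0$. *)
case: (pselect (exists2 e, src e = v & e \notin F)) => [[e se eF]|noe].
  have ze : z ** ledge e = 0.
    rewrite -zF -rmulA /edge_proj rmul_suml.
    rewrite [X in z ** X]big_seq big1 ?rmul0r //.
    move=> f; rewrite mem_undup -rmulA ghost_edge => fF.
    by case: eqP eF fF => [<- /negP|_ _ _]; rewrite ?rmul0r.
  have sv : real_elt s ** lvertex v = 0.
    rewrite -se; apply: real_edge_ker_eq0 => //.
    by rewrite -[X in phi X]addr0 -{1}ze -rmulDl -Dx xe raddf0.
  rewrite Dx rmulDl sv zv add0r /edge_proj rmul_sumr big_seq big1 // => f.
  rewrite mem_filter => /andP[/eqP sf _].
  have := xe f; rewrite Dx rmulDl -(lf_se (leavitt_familyP R E) f) sf.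
  by rewrite !rmulA sv rmul0l add0r => ->; rewrite rmul0l.
have Fv_emits : emits v Fv.
  split; first by apply/NoDupP; rewrite filter_uniq ?undup_uniq.
  move=> f; apply: (iff_trans (InP _ _)); rewrite mem_filter mem_undup.
  split=> [/andP[/eqP]//|sf]; rewrite sf eqxx /=.
  by apply: contrapT => /negP fF; apply: noe; exists f.
(* If [v] is a sink, only real paths of [x] can end there; otherwise relation (5) expands [v] and
   each $xff^*$ vanishes. *)
case: (Fv =P [::]) => [Fv0|/eqP Fv0].
  move: zv; rewrite Fv0 /edge_proj big_nil rmul0r => zv.
  have := kerMr (lvertex v) phi0; rewrite Dx rmulDl zv addr0 real_elt_vertex.
  by apply: real_ker_eq0 => t; rewrite mem_filter => /andP[_ /ws].
rewrite (lf_sum (leavitt_familyP R E) Fv_emits); last exact/eqP.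
by rewrite rmul_sumr big1 // => f _; rewrite rmulA xe rmul0l.
Qed.

Lemma reduction_injective : injective phi.
Proof.
apply: raddf_inj => x phi0.
by have [d /ghost_span_ker_eq0->] := ghost_span_total x.
Qed.

End Reduction.

(** * The representation on maximal paths *)

Section Boundary.
Variables (R : comPzRingType) (E : digraph).
Implicit Types (v w : vertex E) (e f : edge E).

(* A maximal path, finite or infinite, is encoded as the sequence of its
   vertices paired with the edges that leave them; a path that reaches a sink
   stays there for ever, with [None] as edge. *)
Definition trail := nat -> vertex E * option (edge E).

Definition maximal (y : trail) : Prop := forall i,
  match (y i).2 with
  | Some e => src e = (y i).1 /\ (y i.+1).1 = rng e
  | None => (forall e, src e <> (y i).1) /\ (y i.+1).1 = (y i).1
  end.

Definition tail (y : trail) : trail := fun i => y i.+1.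

Definition tcons e (y : trail) : trail :=
  fun i => if i is j.+1 then y j else (src e, Some e).

(** Choose one outgoing edge at every vertex that is not a sink, and follow these choices. *)
Lemma exists_maximal v : exists2 y, maximal y & (y 0%N).1 = v.
Proof.
have /choice [g gP] : forall w, exists o : option (edge E),
    if o is Some e then src e = w else forall e, src e <> w.
  move=> w; case: (pselect (exists e, src e = w)) => [[e ew]|ne].
    by exists (Some e).
  by exists None => e ew; apply: ne; exists e.
pose next w := if g w is Some e then rng e else w.
exists (fun i => (iter i next v, g (iter i next v))) => // i /=.
move: (iter i next v) => w; rewrite /next; have := gP w.
by case: (g w).
Qed.

Lemma maximal_tail y : maximal y -> maximal (tail y).
Proof. by move=> my i; apply: my. Qed.

Lemma maximal_edge y e : maximal y -> (y 0%N).2 = Some e ->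
  (y 0%N).1 = src e /\ (y 1%N).1 = rng e.
Proof. by move=> my ye; have := my 0%N; rewrite ye => -[-> ->]. Qed.

Lemma maximal_cons e y : maximal y -> (y 0%N).1 = rng e -> maximal (tcons e y).
Proof. by move=> my ye [|i] //=; apply: my. Qed.

Lemma tail_cons e y : tail (tcons e y) = y.
Proof. by apply/funext. Qed.

Lemma cons_tail e y : maximal y -> (y 0%N).2 = Some e -> tcons e (tail y) = y.
Proof.
move=> my ye; apply/funext => -[|i] //=; have [<- _] := maximal_edge my ye.
by rewrite -ye -surjective_pairing.
Qed.

(* The integer records a degree, so that a closed path without an exit does not
   act as the identity on the unique maximal path that starts there. *)
Definition fspace := trail -> int -> R.

Definition ind (P : Prop) (a : R) : R := if `[< P >] then a else 0.

Lemma indT (P : Prop) a : P -> ind P a = a.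
Proof. by move=> /asboolP; rewrite /ind => ->. Qed.

Lemma indF (P : Prop) a : ~ P -> ind P a = 0.
Proof. by move=> /asboolPn/negbTE; rewrite /ind => ->. Qed.

Lemma indD (P : Prop) a b : ind P (a + b) = ind P a + ind P b.
Proof. by rewrite /ind; case: ifP; rewrite ?addr0. Qed.

Lemma indZ (P : Prop) a b : ind P (a * b) = a * ind P b.
Proof. by rewrite /ind; case: ifP; rewrite ?mulr0. Qed.

Lemma eq_ind (P Q : Prop) a b : (P <-> Q) -> (P -> a = b) -> ind P a = ind Q b.
Proof.
move=> PQ Pab; case: (pselect P) => p.
  by rewrite !indT ?Pab //; apply/PQ.
by rewrite !indF // => /PQ.
Qed.

Lemma ind_ind (P Q : Prop) a : ind P (ind Q a) = ind (P /\ Q) a.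
Proof.
case: (pselect P) => p; last by rewrite !indF //; case.
by rewrite indT //; apply: eq_ind => //; split=> // -[].
Qed.

(** Edges raise the degree of a function by one and ghost edges lower it. Each generator vanishes
    off the maximal paths, so that the relations hold at every trail. *)
Fixpoint act (t : lterm R E) (h : fspace) : fspace := fun y n =>
  match t with
  | TVertex v => ind (maximal y /\ (y 0%N).1 = v) (h y n)
  | TEdge e => ind (maximal y /\ (y 0%N).2 = Some e) (h (tail y) (n - 1))
  | TGhost e => ind (maximal y /\ (y 0%N).1 = rng e) (h (tcons e y) (n + 1))
  | TZero => 0
  | TAdd t u => act t h y n + act u h y n
  | TScale a t => a * act t h y n
  | TMul t u => act t (act u h) y n
  end.

Lemma actD t h k y n :
  act t (fun y n => h y n + k y n) y n = act t h y n + act t k y n.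
Proof.
elim: t h k y n => [v|e|e||t IHt u IHu|a t IHt|t IHt u IHu] h k y n /=;
  rewrite ?indD ?addr0 ?IHt ?IHu ?mulrDr //; first by rewrite addrACA.
rewrite -IHt; congr act; apply/funext => z; apply/funext => m; exact: IHu.
Qed.

Lemma actZ t a h y n : act t (fun y n => a * h y n) y n = a * act t h y n.
Proof.
elim: t h y n => [v|e|e||t IHt u IHu|b t IHt|t IHt u IHu] h y n /=;
  rewrite ?indZ ?mulr0 ?IHt ?IHu ?mulrDr ?mulrA ?[a * b]mulrC //.
rewrite -IHt; congr act; apply/funext => z; apply/funext => m; exact: IHu.
Qed.

Lemma lcong_act t u : lcong t u -> act t = act u.
Proof.
move=> tu; apply/funext => h; apply/funext => y; apply/funext => n.
elim: tu h y n => {t u} /=.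
- by [].
- by move=> t u _ IH h y n; rewrite IH.
- by move=> t u w _ IH _ IH' h y n; rewrite IH IH'.
- by move=> t t' u u' _ IH _ IH' h y n; rewrite IH IH'.
- by move=> a t t' _ IH h y n; rewrite IH.
- move=> t t' u u' _ IH _ IH' h y n; rewrite IH; congr act.
  by apply/funext => z; apply/funext => m.
- by move=> t u w h y n; rewrite addrA.
- by move=> t u h y n; rewrite addrC.
- by move=> t h y n; rewrite add0r.
- by move=> a b t h y n; rewrite mulrA.
- by move=> t h y n; rewrite mul0r.
- by move=> t h y n; rewrite mul1r.
- by move=> a t u h y n; rewrite mulrDr.
- by move=> a b t h y n; rewrite mulrDl.
- by [].
- by [].
- by move=> t u w h y n; rewrite -actD.
- by [].
- by move=> a t u h y n; rewrite -actZ.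
- by move=> v h y n; rewrite ind_ind; apply: eq_ind => //; split=> // -[].
- move=> v w vw h y n; rewrite ind_ind indF // => -[[_ yv] [_ yw]].
  by apply: vw; rewrite -yv.
- move=> e h y n; rewrite ind_ind; apply: eq_ind => //; split=> [[]//|[my ye]].
  by have [] := maximal_edge my ye.
- move=> e h y n; rewrite ind_ind; apply: eq_ind => //; split=> [[]//|[my ye]].
  have [_ ?] := maximal_edge my ye.
  by split=> //; split=> //; apply: maximal_tail.
- by move=> e h y n; rewrite ind_ind; apply: eq_ind => //; split=> // -[].
- move=> e h y n; rewrite ind_ind; apply: eq_ind => //; split=> [[]//|[my ye]].
  by split=> //; split=> //; apply: maximal_cons.
- move=> e h y n; rewrite ind_ind tail_cons addrK; apply: eq_ind => //.
  split=> [[]//|[my ye]].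
  by split=> //; split=> //; apply: maximal_cons.
- by move=> e f ef h y n; rewrite ind_ind indF // => -[_ [_ [/ef]]].
(* Relation (5): a maximal path from [v] starts with exactly one edge of [l], since [v] is not a
   sink, so one summand survives. *)
move=> v l [/NoDupP ul lv] l0 h y n.
have -> :
    act (foldr (fun f t => TAdd (TMul (TEdge f) (TGhost f)) t) TZero l) h y n
    = \sum_(f <- l) ind (maximal y /\ (y 0%N).2 = Some f) (h y n).
  elim: l {ul lv l0} => [|f l IHl] /=; first by rewrite big_nil.
  rewrite big_cons IHl ind_ind subrK; congr (_ + _); apply: eq_ind.
    split=> [[]//|[my ye]]; split=> //; split; first exact: maximal_tail.
    by have [] := maximal_edge my ye.
  by case=> [[my ye] _]; rewrite cons_tail.
case: (pselect (maximal y /\ (y 0%N).1 = v)) => [[my yv]|nyv]; last first.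
  rewrite indF // big_seq big1 // => f fl; rewrite indF // => -[my yf].
  apply: nyv; split=> //; have [-> _] := maximal_edge my yf.
  by apply/lv/InP.
rewrite indT //; have := my 0%N; case yf: (y 0%N).2 => [f|] [sf _]; last first.
  case: l l0 lv {ul} => // f l _ lv; case: (sf f); rewrite yv.
  by apply/lv; left.
have fl : f \in l by apply/InP/lv; rewrite sf.
rewrite -[LHS](@sum_pred1_uniq _ _ l f (fun=> h y n)) // big_mkcond.
apply: eq_bigr => e _; case: eqP => [->|ef].
  by rewrite indT.
by rewrite indF // => -[_ [/esym/ef]].
Qed.

(** * The induced action of the algebra, and elements that act nontrivially *)

Definition lact (x : leavitt R E) : fspace -> fspace := act (lrepr x).

Lemma lact_pi t : lact (lpi t) = act t.
Proof. exact: lcong_act (lrepr_pi t). Qed.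

Lemma lactD x x' h y n : lact (x + x') h y n = lact x h y n + lact x' h y n.
Proof. by rewrite -(lreprK x) -(lreprK x') -lpiD !lact_pi. Qed.

Lemma lactZ a x h y n : lact (a *: x) h y n = a * lact x h y n.
Proof. by rewrite -(lreprK x) -lpiZ !lact_pi. Qed.

Lemma lactM x x' h : lact (x ** x') h = lact x (lact x' h).
Proof.
rewrite -(lreprK x) -(lreprK x') -lpiM !lact_pi.
by apply/funext => y; apply/funext.
Qed.

Lemma lact0 h y n : lact 0 h y n = 0.
Proof. by rewrite [0]/(lpi TZero) lact_pi. Qed.

Lemma lact_sum I (s : seq I) (F : I -> leavitt R E) h y n :
  lact (\sum_(i <- s) F i) h y n = \sum_(i <- s) lact (F i) h y n.
Proof.
apply: (big_morph (fun x => lact x h y n)) => [x x'|]; first exact: lactD.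
exact: lact0.
Qed.

Lemma lact_vertex v h y n : maximal y -> (y 0%N).1 = v ->
  lact (lvertex v) h y n = h y n.
Proof. by move=> my yv; rewrite lact_pi /= indT. Qed.

(** On the constant function 1, evaluated at a maximal path from [v], the element acts with value
    [r]. *)
Lemma lscale_vertex_neq0 v (r : R) :
  r <> 0 -> r *: (lvertex v : leavitt R E) <> 0.
Proof.
have [y my yv] := exists_maximal v; apply: contra_not => rv0.
have := lact0 (fun _ _ => 1) y 0; rewrite -rv0 lactZ lact_vertex //.
by rewrite mulr1.
Qed.

(* Without an exit, a maximal path has no choice but to follow the walk. *)
Lemma lact_walk w l h y n :
    (forall e f, f \in l -> src e = src f -> e = f) ->
    walk w l -> maximal y -> (y 0%N).1 = w ->
  [/\ maximal (iter (size l) tail y), (iter (size l) tail y 0%N).1 = wend w l &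
    lact (pelt R w l) h y n = h (iter (size l) tail y) (n - (size l)%:Z)].
Proof.
elim: l w y n => [|e l IHl] w y n nox.
  by move=> _ my yw; split=> //; rewrite lact_vertex // subr0.
move=> /andP[/eqP <- wl] my yw.
have [ye ye'] : (y 0%N).2 = Some e /\ (y 1%N).1 = rng e.
  have := my 0%N; case: (y 0%N).2 => [f [sf ->]|[sink _]].
    by rewrite (nox f e) ?mem_head // sf.
  by case: (sink e).
have {IHl}[|m1 m2 m3] :=
  IHl (rng e) (tail y) (n - 1) _ wl (maximal_tail my) ye'.
  by move=> e' f fl; apply: nox; rewrite inE fl orbT.
rewrite [size _]/= iterSr; split=> //.
rewrite pelt_cons lactM lact_pi /= indT // m3; congr (h _ _).
by rewrite intS opprD addrA.
Qed.

Lemma cycle_eval_neq0 (alpha : gpath E) (q : seq R) :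
  is_cycle alpha -> ~ has_exit alpha -> nonzero_poly q ->
  cycle_eval q alpha <> 0.
Proof.
case: alpha => e l cl alphaC alphaX [k qk] q0.
set alpha := GPath cl in alphaC alphaX q0.
pose w := src e; pose c := e :: l.
have wc : walk w c.
  rewrite /= eqxx /=.
  elim: l e cl {w c alpha alphaC alphaX q0} => //= f l IHl e.
  by case=> -> cl; rewrite eqxx IHl.
have cw : wend w c = w.
  by move: (esym alphaC); rewrite /prng -last_map.
have nox e' f : f \in c -> src e' = src f -> e' = f.
  move=> fc ef; apply: contrapT => nef; apply: alphaX.
  by exists e', f => //; apply/InP.
have pE : path_elt R alpha = pelt R w c.
  by rewrite /path_elt /pelt /= vertex_edge eqxx.
have powerP n : walk w (power c n) /\ wend w (power c n) = w.
  exact: power_closed.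
have nox' n e' f : f \in power c n -> src e' = src f -> e' = f.
  by move=> /flattenP[d /nseqP[-> _]]; apply: nox.
pose delta : fspace := fun _ n => if n == 0 then 1 else 0.
have [y my yw] := exists_maximal w.
have lact_power n m : lact (pelt R w (power c n)) delta y (m * size c)%N =
    if n == m then 1 else 0.
  have [wp _] := powerP n.
  have [_ _ ->] := lact_walk delta (m * size c)%N (@nox' n) wp my yw.
  by rewrite /delta size_power subr_eq0 eqz_nat eqn_pmul2r // eq_sym.
apply: qk; rewrite -[RHS](lact0 delta y (k * size c)%N) -q0.
rewrite /cycle_eval lactD lactZ lact_sum (lact_power 0%N k).
(* If [k] is beyond the end of [q], both sides are the default coefficient 0. *)
transitivity (\sum_(0 <= n < size q) if n == k then q`_n else 0).
  rewrite -big_mkcond; case: (ltnP k (size q)) => kq.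
    by rewrite (@sum_pred1_uniq _ _ _ k) ?iota_uniq // mem_index_iota.
  rewrite nth_default // big_nat_cond big1 // => n /andP[/andP[_ nq] /eqP nk].
  by rewrite -nk leqNgt nq in kq.
have Dn n : q`_n * (if n == k then 1 else 0) = if n == k then q`_n else 0.
  by case: eqP; rewrite (mulr1, mulr0).
case: (posnP (size q)) => [|q_gt0].
  by move=> /size0nil ->; rewrite !big_nil nth_nil mul0r addr0.
rewrite big_ltn // Dn; congr (_ + _); rewrite !big_nat.
apply: eq_bigr => n /andP[n0 _].
by rewrite lactZ pE -(prednK n0) -pelt_power // lact_power -Dn prednK.
Qed.

End Boundary.

Theorem theorem3p1 (E : digraph) (R : comPzRingType) (S : rngType)
    (phi : {additive leavitt R E -> S})
    (phiM : {morph phi : x y / x ** y >-> x ** y}) :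
  injective phi <->
  ((forall (v : vertex E) (r : R), r <> 0 -> phi (r *: lvertex v) <> 0) /\
   (forall alpha : gpath E, is_cycle alpha -> ~ has_exit alpha ->
      forall q : seq R, nonzero_poly q -> phi (cycle_eval q alpha) <> 0)).
Proof.
split=> [phiI|[G1 G2]]; last exact: reduction_injective.
have phi_neq0 x : x <> 0 -> phi x <> 0.
  by apply: contra_not => phix0; apply: phiI; rewrite phix0 raddf0.
split=> [v r r0|alpha alphaC alphaX q q0]; apply: phi_neq0.
  exact: lscale_vertex_neq0.
exact: cycle_eval_neq0.
Qed.
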